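(* For $n\in\{1,2,3\}$, the Jordan algebra $\mathcal{J}^2_0$ has no embeddings into $\mathbb{S}^n$. For $4\leq n\leq7$, every embedding of $\mathcal{J}^2_0$ into $\mathbb{S}^n$ is congruent to $$C_{n,i}=\mathbb{C}{\bf J}_n+\operatorname{Diag}(\mathcal{P}_{\lfloor n/2\rfloor,i},{\bf 0}_{\lceil n/2\rceil})$$ for some $i$ (with $i\in\{1,2\}$ if $n\in\{4,5\}$ and $i\in\{1,\dots,8\}$ if $n\in\{6,7\}$), where $$\mathcal{P}_{2,1}:=\begin{pmatrix}x&0\\0&y\end{pmatrix},\quad \mathcal{P}_{2,2}:=\begin{pmatrix}y&x\\ x&0\end{pmatrix},$$ $$\mathcal{P}_{3,1}:=\begin{pmatrix}x&0&0\\0&y&0\\0&0&x+y\end{pmatrix},\quad \mathcal{P}_{3,2}:=\begin{pmatrix}x&y&0\\ y&0&0\\0&0&x\end{pmatrix},\quad \mathcal{P}_{3,3}:=\begin{pmatrix}0&y&x\\ y&x&0\\ x&0&0\end{pmatrix},\quad \mathcal{P}_{3,4}:=\begin{pmatrix}x&0&0\\0&x&0\\0&0&y\end{pmatrix},$$ $$\mathcal{P}_{3,5}:=\begin{pmatrix}y&x&0\\ x&0&0\\0&0&x\end{pmatrix},\quad \mathcal{P}_{3,6}:=\begin{pmatrix}0&x&y\\ x&0&0\\ y&0&0\end{pmatrix},\quad \mathcal{P}_{3,7}:=\begin{pmatrix}x&0&0\\0&y&0\\0&0&0\end{pmatrix},\quad \mathcal{P}_{3,8}:=\begin{pmatrix}y&x&0\\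 x&0&0\\0&0&0\end{pmatrix}.$$
   Context: $\mathbb{S}^n$ is the space of complex symmetric $n\times n$ matrices. A (unital) Jordan algebra is a complex vector space with a symmetric bilinear product satisfying $(x\cdot x)\cdot(x\cdot y)=x\cdot((x\cdot x)\cdot y)$ for all $x,y$ and having a unit; morphisms are linear maps preserving products and units. For an invertible $U\in\mathbb{S}^n$, the product $X\bullet_U Y=\frac12(XU^{-1}Y+YU^{-1}X)$ makes $\mathbb{S}^n$ a unital Jordan algebra with unit $U$. An embedding of a Jordan algebra $\mathcal{A}$ into $\mathbb{S}^n$ is the image of an injective morphism of unital Jordan algebras $\mathcal{A}\to(\mathbb{S}^n,\bullet_U)$ for some invertible $U\in\mathbb{S}^n$. Two subspaces $\mathcal{L},\mathcal{L}'\subseteq\mathbb{S}^n$ are congruent if $\mathcal{L}'=P\mathcal{L}P^\top$ for some $P\in\mathrm{GL}_n(\mathbb{C})$. $\mathcal{J}^2_0$ is the $3$-dimensional Jordan algebra $\mathbb{C}\times\mathbb{C}^2$ with product $(\lambda,v)\cdot(\mu,w)=(\lambda\mu,\lambda w+\mu v)$. A matrix whose entries are linear forms in indeterminates $x,y$ denotes the linear space of all matrices obtained by substituting complex numbers for the indeterminates. ${\bf 0}_k$ is the $k\times k$ zero matrix, ${\bf J}_n$ is the $n\times n$ matrix with $1$'s on the anti-diagonal and $0$'s elsewhere, and $\operatorname{Diag}(\dots)$ is the block-diagonal matrix with the given blocks. *)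

(* Defs.v *)
From HB Require Import structures.
From mathcomp Require Import all_boot all_order all_algebra.
From mathcomp Require Import complex.
From mathcomp Require Import ring.
From mathcomp Require Import classical_sets.

Set Implicit Arguments.
Unset Strict Implicit.
Unset Printing Implicit Defensive.

Import Order.TTheory GRing.Theory Num.Theory.
Local Open Scope classical_set_scope.
Local Open Scope ring_scope.

Section JordanAlgebras.
Variable F : fieldType.

(* Linearity in the first argument follows from [jmulC]. *)
Record jordanAlgebra := JordanAlgebra {
  jcarrier :> lmodType F;
  jmul : jcarrier -> jcarrier -> jcarrier;
  jone : jcarrier;
  jmulC : commutative jmul;
  jmul_linear : forall x, linear (jmul x);
  jmul_jordan : forall x y,
    jmul (jmul x x) (jmul x y) = jmul x (jmul (jmul x x) y);
  jmul1 : left_id jone jmul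
}.

Definition jordan_morphism (A B : jordanAlgebra) (f : A -> B) : Prop :=
  [/\ linear f,
      forall x y, f (jmul x y) = jmul (f x) (f y) &
      f (jone A) = jone B].

Definition J20_mul (p q : F^o * 'rV[F]_2) : F^o * 'rV[F]_2 :=
  (p.1 * q.1, (p.1 : F) *: q.2 + (q.1 : F) *: p.2).

Lemma J20_mulC : commutative J20_mul.
Proof. by move=> [a v] [b w]; rewrite /J20_mul /= mulrC addrC. Qed.

Lemma J20_mul_linear p : linear (J20_mul p).
Proof.
case: p => a v c [b w] [b' w']; rewrite /J20_mul /=; congr pair => /=.
  by rewrite mulrDr scalerAr.
by apply/rowP => k; rewrite !mxE /= /GRing.scale /=; ring.
Qed.

Lemma J20_mul_jordan p q :
  J20_mul (J20_mul p p) (J20_mul p q) = J20_mul p (J20_mul (J20_mul p p) q).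
Proof.
case: p q => a v [b w]; rewrite /J20_mul /=; congr pair.
  by rewrite /= !mulrA.
by apply/rowP => k; rewrite !mxE /=; ring.
Qed.

Lemma J20_mul1 : left_id ((1, 0) : F^o * 'rV[F]_2) J20_mul.
Proof. by move=> [b w]; rewrite /J20_mul /= mul1r scale1r scaler0 addr0. Qed.

Definition J20 : jordanAlgebra :=
  JordanAlgebra J20_mulC J20_mul_linear J20_mul_jordan J20_mul1.

End JordanAlgebras.

Lemma symmetricmxP (F : fieldType) n (A : 'M[F]_n) :
  reflect (A^T = A) (A \is symmetricmx).
Proof.
rewrite qualifE /= expr0 scale1r map_mx_id //.
by apply: (iffP eqP) => /esym.
Qed.

Section SymmetricMatrices.
Variables (F : fieldType) (n : nat).

Definition symmx_pred : pred 'M[F]_n := fun A => A \is symmetricmx.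

Lemma symmx_pred_closed : submod_closed symmx_pred.
Proof.
split=> [|a A B /symmetricmxP sA /symmetricmxP sB]; apply/symmetricmxP.
  by rewrite trmx0.
by rewrite linearP /= sA sB.
Qed.

HB.instance Definition _ :=
  GRing.isSubmodClosed.Build F 'M[F]_n symmx_pred symmx_pred_closed.

Record symmx := SymMx { symmx_val :> 'M[F]_n; _ : symmx_pred symmx_val }.

HB.instance Definition _ := [isSub for symmx_val].
HB.instance Definition _ := [Choice of symmx by <:].
HB.instance Definition _ := [SubChoice_isSubLmodule of symmx by <:].

End SymmetricMatrices.

Notation "''S[' F ]_ n" := (symmx F n)
  (at level 0, n at level 2, format "''S[' F ]_ n") : type_scope.

Section SymmetricJordan.
Variables (F : numFieldType) (n : nat).
Implicit Types U X Y : 'S[F]_n.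

Definition bullet_mx (U X Y : 'M[F]_n) : 'M[F]_n :=
  2^-1 *: (X *m invmx U *m Y + Y *m invmx U *m X).

Fact bullet_subproof U X Y : symmx_pred (bullet_mx U X Y).
Proof.
have tr (Z : 'S[F]_n) : (Z : 'M_n)^T = Z by apply/symmetricmxP/(valP Z).
apply/symmetricmxP; rewrite /bullet_mx linearZ linearD /= !trmx_mul trmx_inv !tr.
by rewrite addrC !mulmxA.
Qed.

Definition bullet U X Y : 'S[F]_n := SymMx (bullet_subproof U X Y).

Lemma bulletC U : commutative (bullet U).
Proof. by move=> X Y; apply/val_inj; rewrite /= /bullet_mx addrC. Qed.

Lemma bullet_linear U X : linear (bullet U X).
Proof.
move=> a Y Z; apply/val_inj; rewrite /= /bullet_mx.
rewrite mulmxDr !mulmxDl -!scalemxAr -!scalemxAl.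
rewrite addrACA -scalerDr [LHS]scalerDr !scalerA.
by rewrite mulrC.
Qed.

Lemma bullet_jordan U X Y :
  bullet U (bullet U X X) (bullet U X Y) =
  bullet U X (bullet U (bullet U X X) Y).
Proof.
apply/val_inj; rewrite /= /bullet_mx.
set V := invmx U.
rewrite !(mulmxDr, mulmxDl, scalerDr, =^~ scalemxAr, =^~ scalemxAl).
rewrite !scalerA !mulmxA.
by rewrite [X in _ + X = _]addrACA [LHS]addrACA.
Qed.

Lemma bullet1 U : symmx_val U \in unitmx -> left_id U (bullet U).
Proof.
move=> hU X; apply/val_inj; rewrite /= /bullet_mx mulmxV // mul1mx.
rewrite -mulmxA mulVmx // mulmx1 -mulr2n -scaler_nat scalerA mulVf ?scale1r //.
by rewrite pnatr_eq0.
Qed.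

Definition symJordan U (hU : symmx_val U \in unitmx) : jordanAlgebra F :=
  JordanAlgebra (@bulletC U) (@bullet_linear U) (@bullet_jordan U) (bullet1 hU).

Definition jordan_embedding (A : jordanAlgebra F) (L : set 'M[F]_n) : Prop :=
  exists (U : 'S[F]_n) (hU : symmx_val U \in unitmx) (f : A -> symJordan hU),
    [/\ jordan_morphism f, injective f & L = [set symmx_val (f a) | a in setT]].

Definition congruent (L L' : set 'M[F]_n) : Prop :=
  exists2 P : 'M[F]_n, P \in unitmx & L' = [set P *m X *m P^T | X in L].

End SymmetricJordan.

Section Pencils.
Variable F : fieldType.

Definition mx_of_rows m (s : seq (seq F)) : 'M[F]_m :=
  \matrix_(a, b) (nth [::] s a)`_b.

(* The junk value outside the tabulated pairs (m, i) is the zero matrix. *)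
Definition pencil (m i : nat) (x y : F) : 'M[F]_m :=
  mx_of_rows m
    match m, i with
    | 2, 1 => [:: [:: x; 0]; [:: 0; y]]
    | 2, 2 => [:: [:: y; x]; [:: x; 0]]
    | 3, 1 => [:: [:: x; 0; 0]; [:: 0; y; 0]; [:: 0; 0; x + y]]
    | 3, 2 => [:: [:: x; y; 0]; [:: y; 0; 0]; [:: 0; 0; x]]
    | 3, 3 => [:: [:: 0; y; x]; [:: y; x; 0]; [:: x; 0; 0]]
    | 3, 4 => [:: [:: x; 0; 0]; [:: 0; x; 0]; [:: 0; 0; y]]
    | 3, 5 => [:: [:: y; x; 0]; [:: x; 0; 0]; [:: 0; 0; x]]
    | 3, 6 => [:: [:: 0; x; y]; [:: x; 0; 0]; [:: y; 0; 0]]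
    | 3, 7 => [:: [:: x; 0; 0]; [:: 0; y; 0]; [:: 0; 0; 0]]
    | 3, 8 => [:: [:: y; x; 0]; [:: x; 0; 0]; [:: 0; 0; 0]]
    | _, _ => [::]
    end.

Definition antidiag_mx n : 'M[F]_n := \matrix_(a, b) (b == rev_ord a)%:R.

Fact half_add_uphalf n : (n./2 + uphalf n = n)%N.
Proof. by rewrite uphalf_half addnCA addnn odd_double_half. Qed.

(* Diag(A, 0): the blocks have sizes floor(n/2) and ceil(n/2). *)
Definition diag_mx0 n (A : 'M[F]_(n./2)) : 'M[F]_n :=
  castmx (half_add_uphalf n, half_add_uphalf n)
    (block_mx A 0 0 (0 : 'M_(uphalf n))).

Definition Cspace n i : set 'M[F]_n :=
  [set M | exists c x y : F,
             M = c *: antidiag_mx n + diag_mx0 (pencil n./2 i x y)].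

End Pencils.

Arguments Cspace F n i : clear implicits.

(* Main.v *)
Require Import Defs.
From mathcomp Require Import all_boot all_order all_algebra.
From mathcomp Require Import complex ring zify.
From mathcomp Require Import classical_sets reals.

(**
Let U be the unit of an embedding L, V its inverse, and A, B the images of a
basis of the nilpotent part of J20.  The products of J20 say exactly that
X V Y + Y V X = 0 for X, Y among A, B, so A V and B V are square-zero and
anticommute.

The bound n <= 7 forces A V B = 0 ([small_products_vanish]): A V B is
skew-symmetric, hence of rank 0 or at least 2, while two anticommuting
square-zero endomorphisms whose product has rank r need a space of dimension
at least 4 r (a vector not killed by the product generates a free module over
the exterior algebra on two generators).

Once all products vanish, the rows of A and B span a totally isotropic
subspace for the symmetric bilinear form V.  It is contained in an isotropic
subspace of dimension exactly n/2, rounded down ([maximal_isotropic]), and by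
Witt's theorem ([witt_extension]) a congruence moves U to the antidiagonal
matrix and that subspace to the span of the first n/2 coordinate vectors.  Then
A and B are supported on the upper left corner ([embedding_corner]), and the
whole problem becomes that of classifying two-dimensional spaces of symmetric
matrices of size n/2 up to congruence.  The basis of the isotropic subspace can be
chosen freely, which realises every congruence of the corner.

If n <= 3 the corner has size at most one, so it holds no two-dimensional
space.  For size 2 and 3 the pencil contains a singular matrix C
([singular_member]).  In size 3 either C can be taken of rank one, or C has
rank two and becomes the hyperbolic form 2 x1 x2; in both cases the second
generator is reduced by changes of basis adapted to C ([rank1_pencil],
[hyperbolic_pencil]), and the leaves of the case analysis are the eight
tabulated pencils.
*)

Set Implicit Arguments.
Unset Strict Implicit.
Unset Printing Implicit Defensive.

Import Order.TTheory GRing.Theory Num.Theory.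
Local Open Scope classical_set_scope.
Local Open Scope ring_scope.

(** * Linearly independent pairs *)

Definition indep (F : fieldType) (V : lmodType F) (A B : V) :=
  forall x y : F, x *: A + y *: B = 0 -> x = 0 /\ y = 0.

Lemma not_indep_comb (F : fieldType) (V : lmodType F) (A B : V) (x y : F) :
  x *: A + y *: B = 0 -> (x != 0) || (y != 0) -> ~ indep A B.
Proof. by move=> h hxy /(_ _ _ h) [x0 y0]; rewrite x0 y0 eqxx in hxy. Qed.

Lemma indep_comb (F : fieldType) (V : lmodType F) (A B : V) (a b c d : F) :
  indep (a *: A + b *: B) (c *: A + d *: B) -> a * d - b * c != 0.
Proof.
move=> hi; apply/eqP => h0.
have [|d0 /eqP] := hi d (- b).
  rewrite !scalerDr !scalerA addrACA -!scalerDl.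
  have -> : d * a + - b * c = a * d - b * c by ring.
  have -> : d * b + - b * d = 0 by ring.
  by rewrite h0 !scale0r addr0.
rewrite oppr_eq0 => /eqP b0.
have [|_ /eqP] := hi c (- a).
  rewrite b0 d0 !scale0r !addr0 !scalerA -scalerDl.
  have -> : c * a + - a * c = 0 by ring.
  by rewrite scale0r.
rewrite oppr_eq0 => /eqP a0.
have [|/eqP + _] := hi 1 0; last by rewrite oner_eq0.
by rewrite a0 b0 !scale0r !addr0 scaler0.
Qed.

Lemma comb_indep (F : fieldType) (V : lmodType F) (A B : V) (a b c d : F) :
  a * d - b * c != 0 -> indep A B ->
  indep (a *: A + b *: B) (c *: A + d *: B).
Proof.
move=> hD hi x y.
rewrite !scalerDr !scalerA addrACA -!scalerDl => /hi [h1 h2].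
have hx : x = ((x * a + y * c) * d - (x * b + y * d) * c) / (a * d - b * c).
  by field.
have hy : y = ((x * b + y * d) * a - (x * a + y * c) * b) / (a * d - b * c).
  by field.
by rewrite h1 h2 !mul0r subrr mul0r in hx hy.
Qed.

Lemma solve_comb (F : fieldType) (V : lmodType F) (A B : V) (a b c d : F) :
  a * d - b * c != 0 -> forall x y, exists x' y',
  x *: A + y *: B = x' *: (a *: A + b *: B) + y' *: (c *: A + d *: B).
Proof.
move=> hD x y.
exists ((x * d - y * c) / (a * d - b * c)), ((y * a - x * b) / (a * d - b * c)).
rewrite !scalerDr !scalerA addrACA -!scalerDl.
by congr (_ *: _ + _ *: _); field.
Qed.

(** * Pencils congruent to a tabulated one *)

Section Tabulated.
Variables (F : fieldType) (m : nat).
Implicit Types A B g : 'M[F]_m.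

Definition cong_comb g A B M :=
  exists x y, M = g *m (x *: A + y *: B) *m g^T.

(** Independence is a premise rather than a side condition because the
    degenerate leaves of the classification are exactly those where it fails.
    Only the two generators of the tabulated pencil are asked to lie in the
    congruent image of the span; equality follows by dimension. *)
Definition tabulated K A B := indep A B ->
  exists2 k : nat, (1 <= k <= K)%N &
  exists2 g, g \in unitmx &
    cong_comb g A B (pencil m k 1 0) /\ cong_comb g A B (pencil m k 0 1).

Lemma tabulated_pencil K k : (1 <= k <= K)%N ->
  tabulated K (pencil m k 1 0) (pencil m k 0 1).
Proof.
move=> hk _; exists k => //; exists 1%:M; rewrite ?unitmx1 //.
split; [exists 1, 0|exists 0, 1];
  by rewrite trmx1 mulmx1 mul1mx scale1r scale0r ?addr0 ?add0r.
Qed.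

Lemma congr_comb g A B x y :
  x *: (g *m A *m g^T) + y *: (g *m B *m g^T) = g *m (x *: A + y *: B) *m g^T.
Proof. by rewrite mulmxDr mulmxDl -!scalemxAr -!scalemxAl. Qed.

Lemma indep_congr g A B : g \in unitmx -> indep A B ->
  indep (g *m A *m g^T) (g *m B *m g^T).
Proof.
move=> ug hi x y.
rewrite congr_comb => /(congr1 (mulmx^~ (invmx g^T))).
rewrite mulmxK ?unitmx_tr // mul0mx => /(congr1 (mulmx (invmx g))).
by rewrite mulKmx // mulmx0; apply: hi.
Qed.

(** One reduction step of the classification: congruence by [g] combined with a
    change of generators of the span. *)
Lemma tabulated_change K g (a b c d : F) A B :
  g \in unitmx -> a * d - b * c != 0 ->
  tabulated K (g *m (a *: A + b *: B) *m g^T) (g *m (c *: A + d *: B) *m g^T) ->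
  tabulated K A B.
Proof.
move=> ug hD ht hi.
have [|k hk [h uh [h1 h2]]] := ht; first exact/indep_congr/comb_indep.
exists k => //; exists (h *m g); first by rewrite unitmx_mul uh.
have pull M : cong_comb h (g *m (a *: A + b *: B) *m g^T)
    (g *m (c *: A + d *: B) *m g^T) M -> cong_comb (h *m g) A B M.
  case=> x [y ->]; exists (x * a + y * c), (x * b + y * d).
  rewrite congr_comb trmx_mul !mulmxA; congr (_ *m _ *m _ *m _).
  by rewrite !scalerDr !scalerA addrACA -!scalerDl.
by split; apply: pull.
Qed.

End Tabulated.

(** * Symmetric matrices of size two and three in coordinates *)

Section Classification.
Variable F : numClosedFieldType.
Implicit Types a b c d e f : F.

Definition sym2 (a b d : F) : 'M[F]_2 := mx_of_rows 2 [:: [:: a; b]; [:: b; d]].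

Lemma sym2E (A : 'M[F]_2) : A^T = A -> A = sym2 (A 0 0) (A 0 1) (A 1 1).
Proof.
move=> sA; have eqA (i j k l : 'I_2) : i = k :> nat -> j = l :> nat -> A i j = A k l.
  by move=> /val_inj-> /val_inj->.
have eqAT (i j k l : 'I_2) : i = l :> nat -> j = k :> nat -> A i j = A k l.
  by move=> il jk; rewrite -[in LHS]sA mxE; apply: eqA.
apply/matrixP => i j; rewrite !mxE.
by case: i => [[|[|//]] hi]; case: j => [[|[|//]] hj] /=;
  (exact: eqA || exact: eqAT).
Qed.

Lemma sym2_comb (x y a b d a' b' d' : F) :
  x *: sym2 a b d + y *: sym2 a' b' d' =
  sym2 (x * a + y * a') (x * b + y * b') (x * d + y * d').
Proof.
apply/matrixP => i j; rewrite !mxE.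
by case: i => [[|[|//]] hi]; case: j => [[|[|//]] hj].
Qed.

Lemma sym2_0 : sym2 0 0 0 = 0 :> 'M[F]_2.
Proof.
apply/matrixP => i j; rewrite !mxE.
by case: i => [[|[|//]] hi]; case: j => [[|[|//]] hj].
Qed.

Definition bil2 (a b d : F) (u v : F * F) :=
  a * u.1 * v.1 + b * (u.1 * v.2 + u.2 * v.1) + d * u.2 * v.2.

Definition rows2 (u v : F * F) : 'M[F]_2 :=
  mx_of_rows 2 [seq [:: p.1; p.2] | p <- [:: u; v]].

Lemma sym2_congr (a b d : F) (u v : F * F) :
  let q := bil2 a b d in
  rows2 u v *m sym2 a b d *m (rows2 u v)^T = sym2 (q u u) (q u v) (q v v).
Proof.
case: u v => [u1 u2] [v1 v2].
apply/matrixP => i j; rewrite !(mxE, big_ord_recl, big_ord0) /bil2 /=.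
by case: i => [[|[|//]] hi]; case: j => [[|[|//]] hj] /=; ring.
Qed.

Definition det2 (u v : F * F) := u.1 * v.2 - u.2 * v.1.

Lemma det_rows2 (u v : F * F) : \det (rows2 u v) = det2 u v.
Proof.
rewrite (expand_det_row _ ord0) !big_ord_recl big_ord0 /cofactor !det_mx11.
by rewrite !mxE /= /bump /det2 /=; ring.
Qed.

(** [tabulated_change] with all data explicit.  The two determinants are separate
    variables so that their closed forms are supplied by the caller, which
    makes their nonvanishing evident. *)
Lemma change_basis2 K (u v : F * F) (x y z t det coef : F)
    (a b d a' b' d' : F) (A B : 'M[F]_2) :
  det2 u v = det -> det != 0 -> x * t - y * z = coef -> coef != 0 ->
  let q := bil2 (x * a + y * a') (x * b + y * b') (x * d + y * d') in
  let r := bil2 (z * a + t * a') (z * b + t * b') (z * d + t * d') in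
  sym2 (q u u) (q u v) (q v v) = A -> sym2 (r u u) (r u v) (r v v) = B ->
  tabulated K A B -> tabulated K (sym2 a b d) (sym2 a' b' d').
Proof.
move=> <- hD <- hc q r <- <-; rewrite -!sym2_congr -!sym2_comb.
by apply: tabulated_change hc; rewrite unitmxE unitfE det_rows2.
Qed.

Definition sym3 (a b c d e f : F) : 'M[F]_3 :=
  mx_of_rows 3 [:: [:: a; b; c]; [:: b; d; e]; [:: c; e; f]].

Lemma sym3E (A : 'M[F]_3) : A^T = A ->
  A = sym3 (A 0 0) (A 0 1) (A 0 ord_max) (A 1 1) (A 1 ord_max)
           (A ord_max ord_max).
Proof.
move=> sA; have eqA (i j k l : 'I_3) : i = k :> nat -> j = l :> nat -> A i j = A k l.
  by move=> /val_inj-> /val_inj->.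
have eqAT (i j k l : 'I_3) : i = l :> nat -> j = k :> nat -> A i j = A k l.
  by move=> il jk; rewrite -[in LHS]sA mxE; apply: eqA.
apply/matrixP => i j; rewrite !mxE.
by case: i => [[|[|[|//]]] hi]; case: j => [[|[|[|//]]] hj] /=;
  (exact: eqA || exact: eqAT).
Qed.

Lemma sym3_comb (x y a b c d e f a' b' c' d' e' f' : F) :
  x *: sym3 a b c d e f + y *: sym3 a' b' c' d' e' f' =
  sym3 (x * a + y * a') (x * b + y * b') (x * c + y * c')
       (x * d + y * d') (x * e + y * e') (x * f + y * f').
Proof.
apply/matrixP => i j; rewrite !mxE.
by case: i => [[|[|[|//]]] hi]; case: j => [[|[|[|//]]] hj].
Qed.

Lemma sym3_0 : sym3 0 0 0 0 0 0 = 0 :> 'M[F]_3.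
Proof.
apply/matrixP => i j; rewrite !mxE.
by case: i => [[|[|[|//]]] hi]; case: j => [[|[|[|//]]] hj].
Qed.

Definition bil3 (a b c d e f : F) (u v : F * F * F) :=
  let: (u1, u2, u3) := u in let: (v1, v2, v3) := v in
  a * u1 * v1 + d * u2 * v2 + f * u3 * v3 + b * (u1 * v2 + u2 * v1)
  + c * (u1 * v3 + u3 * v1) + e * (u2 * v3 + u3 * v2).

Definition rows3 (u v w : F * F * F) : 'M[F]_3 :=
  mx_of_rows 3 [seq [:: p.1.1; p.1.2; p.2] | p <- [:: u; v; w]].

Lemma sym3_congr (a b c d e f : F) (u v w : F * F * F) :
  let q := bil3 a b c d e f in
  rows3 u v w *m sym3 a b c d e f *m (rows3 u v w)^T =
  sym3 (q u u) (q u v) (q u w) (q v v) (q v w) (q w w).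
Proof.
case: u v w => [[u1 u2] u3] [[v1 v2] v3] [[w1 w2] w3].
apply/matrixP => i j; rewrite !(mxE, big_ord_recl, big_ord0) /=.
by case: i => [[|[|[|//]]] hi]; case: j => [[|[|[|//]]] hj] /=; ring.
Qed.

Definition det3 (u v w : F * F * F) :=
  let: (u1, u2, u3) := u in let: (v1, v2, v3) := v in
  let: (w1, w2, w3) := w in
  u1 * (v2 * w3 - v3 * w2) - u2 * (v1 * w3 - v3 * w1) + u3 * (v1 * w2 - v2 * w1).

Lemma det_rows3 (u v w : F * F * F) : \det (rows3 u v w) = det3 u v w.
Proof.
case: u v w => [[u1 u2] u3] [[v1 v2] v3] [[w1 w2] w3].
rewrite (expand_det_row _ ord0) !big_ord_recl big_ord0 /cofactor.
rewrite !(expand_det_row _ ord0) !big_ord_recl !big_ord0 /cofactor !det_mx11.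
by rewrite !mxE /= /bump /=; ring.
Qed.

Lemma change_basis3 K (u v w : F * F * F) (x y z t det coef : F)
    (a b c d e f a' b' c' d' e' f' : F) (A B : 'M[F]_3) :
  det3 u v w = det -> det != 0 -> x * t - y * z = coef -> coef != 0 ->
  let q := bil3 (x * a + y * a') (x * b + y * b') (x * c + y * c')
       (x * d + y * d') (x * e + y * e') (x * f + y * f') in
  let r := bil3 (z * a + t * a') (z * b + t * b') (z * c + t * c')
       (z * d + t * d') (z * e + t * e') (z * f + t * f') in
  sym3 (q u u) (q u v) (q u w) (q v v) (q v w) (q w w) = A ->
  sym3 (r u u) (r u v) (r u w) (r v v) (r v w) (r w w) = B ->
  tabulated K A B ->
  tabulated K (sym3 a b c d e f) (sym3 a' b' c' d' e' f').
Proof.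
move=> <- hD <- hc q r <- <-; rewrite -!sym3_congr -!sym3_comb.
by apply: tabulated_change hc; rewrite unitmxE unitfE det_rows3.
Qed.

Ltac field_nz :=
  first [field | field: (sqrCi F)]; do ?[apply/andP; split]; done.

Ltac nz :=
  rewrite ?(oppr_eq0, oner_eq0, invr_eq0, mulf_eq0, negb_or, pnatr_eq0,
    neq0Ci); do ?[apply/andP; split]; done.

Ltac sym2_eq := rewrite /bil2 /=; congr (sym2 _ _ _); field_nz.

Ltac sym3_eq := rewrite /bil3; congr (sym3 _ _ _ _ _ _); field_nz.

(** [basis u v w of_det D comb x y z t of_det D'] reduces the goal for a pencil
    spanned by A and B to the premise on top of the goal, which concerns
    x A + y B and z A + t B written in the basis u, v, w; D and D' are the two
    determinants. *)
Tactic Notation "basis" uconstr(u) uconstr(v) uconstr(w)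
  "of_det" uconstr(det)
  "comb" uconstr(x) uconstr(y) uconstr(z) uconstr(t) "of_det" uconstr(coef) :=
  let h := fresh "h" in intro h;
  refine (@change_basis3 _ u v w x y z t det coef
    _ _ _ _ _ _ _ _ _ _ _ _ _ _ _ _ _ _ _ _ h);
  [rewrite /det3; field_nz | nz | field_nz | nz | sym3_eq | sym3_eq].

Tactic Notation "basis" uconstr(u) uconstr(v)
  "of_det" uconstr(det)
  "comb" uconstr(x) uconstr(y) uconstr(z) uconstr(t) "of_det" uconstr(coef) :=
  let h := fresh "h" in intro h;
  refine (@change_basis2 _ u v x y z t det coef
    _ _ _ _ _ _ _ _ _ _ _ _ _ _ h);
  [rewrite /det2 /=; field_nz | nz | field_nz | nz | sym2_eq | sym2_eq].

Lemma quadratic_root a b d : d != 0 -> exists t, a + 2 * b * t + d * t ^+ 2 = 0.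
Proof.
move=> d0; have := sqrtCK (b ^+ 2 - a * d); set s := sqrtC _ => hs.
exists ((s - b) / d).
have -> : a + 2 * b * ((s - b) / d) + d * ((s - b) / d) ^+ 2
   = (s ^+ 2 - (b ^+ 2 - a * d)) / d by field.
by rewrite hs subrr mul0r.
Qed.

Lemma square_root a : exists s : F, s ^+ 2 = a.
Proof. by exists (sqrtC a); rewrite sqrtCK. Qed.

(** * Pencils with a singular member *)

(** If B is invertible, an eigenvector of A B^-1 for the eigenvalue t is a kernel
    vector of A - t B. *)
Lemma singular_member m (A B : 'M[F]_m.+1) :
  exists x y (v : 'rV_m.+1),
    [/\ (x != 0) || (y != 0), v != 0 & v *m (x *: A + y *: B) = 0].
Proof.
have [uB|] := boolP (B \in unitmx); last first.
  rewrite unitmxE unitfE negbK => /det0P [v v0 hv].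
  by exists 0, 1, v; rewrite oner_eq0 orbT scale0r scale1r add0r.
have /closed_rootP [t] : size (char_poly (A *m invmx B)) != 1.
  by rewrite size_char_poly.
rewrite -eigenvalue_root_char => /eigenvalueP [v hv v0].
exists 1, (- t), v; rewrite oner_eq0; split=> //.
rewrite mulmxDr scale1r -scalemxAr scaleNr -{1}(mulmxKV uB A) mulmxA hv.
by rewrite -scalemxAl subrr.
Qed.

Lemma complete_row m (v : 'rV[F]_m.+1) i : v != 0 ->
  exists2 g, g \in unitmx & row i g = v.
Proof.
move=> v0; have hv : delta_mx 0 i *m (\matrix_(j < m.+1) v) = v.
  by rewrite -rowE rowK.
have [|g ug hg] := @complete_unitmx F 1 m.+1 (delta_mx 0 i) (\matrix_j v).
  by rewrite hv mxrank_delta rank_rV v0.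
by exists g; rewrite // rowE -hg.
Qed.

(** Taking the kernel vector of a singular member as a basis vector, the first
    generator may be assumed to have a zero row at a prescribed place. *)
Lemma tabulated_singular m K (A B : 'M[F]_m.+1) i :
  A^T = A -> B^T = B ->
  (forall C D : 'M[F]_m.+1, C^T = C -> D^T = D -> row i C = 0 -> tabulated K C D) ->
  tabulated K A B.
Proof.
move=> sA sB h; have [x [y [v [xy v0 hv]]]] := singular_member A B.
have [g ug gi] := complete_row i v0.
have sym z t : (g *m (z *: A + t *: B) *m g^T)^T = g *m (z *: A + t *: B) *m g^T.
  by rewrite !trmx_mul trmxK linearD !linearZ /= sA sB mulmxA.
have r0 : row i (g *m (x *: A + y *: B) *m g^T) = 0.
  by rewrite !row_mul gi hv mul0mx.
have [x0|x0] := eqVneq x 0; [rewrite x0 eqxx /= in xy; pose zt := (1 : F, 0 : F)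
  | pose zt := (0 : F, 1 : F)].
all: apply: (@tabulated_change _ _ _ g x y zt.1 zt.2 _ _ ug); last exact: h.
  by rewrite x0 mul0r sub0r mulr1 oppr_eq0.
by rewrite mulr0 subr0 mulr1.
Qed.

(** * Pencils of binary quadratic forms *)

(** If the second form is nonzero on the kernel vector of the first one, the
    kernel vector splits off orthogonally and both forms become diagonal. *)
Lemma singular_pencil2 a a' b' d' :
  tabulated 2 (sym2 a 0 0) (sym2 a' b' d').
Proof.
have [-> |a0] := eqVneq a 0.
  move=> hi; case: (@not_indep_comb _ _ _ _ 1 0 _ _ hi).
    by rewrite sym2_comb -sym2_0; congr sym2; ring.
  by rewrite oner_eq0.
have [-> |d0] := eqVneq d' 0; last first.
  have type1 : tabulated 2 (sym2 (1 : F) 0 0) (sym2 0 0 1).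
    exact: (@tabulated_pencil F 2 2 1 isT).
  move: type1.
  basis (1, - b' / d') (0, 1) of_det 1
  comb (a^-1) 0 ((b' ^+ 2 / d' - a') / (a * d')) (d'^-1) of_det ((a * d')^-1).
have [-> |b0] := eqVneq b' 0; last first.
  have type2 : tabulated 2 (sym2 (0 : F) 1 0) (sym2 1 0 0).
    exact: (@tabulated_pencil F 2 2 2 isT).
  move: type2.
  basis (1, 0) (0, b'^-1) of_det (b'^-1)
  comb (- a' / a) 1 (a^-1) 0 of_det (- a^-1).
move=> hi; case: (@not_indep_comb _ _ _ _ (- a' / a) 1 _ _ hi).
  by rewrite sym2_comb -sym2_0; congr sym2; field.
by rewrite oner_eq0 orbT.
Qed.

Lemma tabulated_sym2 (A B : 'M[F]_2) : A^T = A -> B^T = B -> tabulated 2 A B.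
Proof.
move=> sA sB; apply: (@tabulated_singular _ _ _ _ 1) => // C D sC sD r0.
rewrite (sym2E sC) (sym2E sD).
have C0 j : C j 1 = 0 by rewrite -sC; move/rowP/(_ j): r0; rewrite !mxE.
by rewrite !C0; apply: singular_pencil2.
Qed.

(** * Pencils of ternary quadratic forms *)

(** Generators of the tabulated pencils in the coordinates of [sym3], to be
    matched with the outcome of a change of basis. *)
Lemma pencil3_type1 : tabulated 8 (sym3 1 0 0 0 0 1 : 'M[F]_3) (sym3 0 0 0 1 0 1).
Proof. by have := @tabulated_pencil F 3 8 1 isT; rewrite /pencil addr0 add0r. Qed.

Lemma pencil3_type2 : tabulated 8 (sym3 1 0 0 0 0 1 : 'M[F]_3) (sym3 0 1 0 0 0 0).
Proof. exact: (@tabulated_pencil F 3 8 2 isT). Qed.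

Lemma pencil3_type3 : tabulated 8 (sym3 0 0 1 1 0 0 : 'M[F]_3) (sym3 0 1 0 0 0 0).
Proof. exact: (@tabulated_pencil F 3 8 3 isT). Qed.

Lemma pencil3_type4 : tabulated 8 (sym3 1 0 0 1 0 0 : 'M[F]_3) (sym3 0 0 0 0 0 1).
Proof. exact: (@tabulated_pencil F 3 8 4 isT). Qed.

Lemma pencil3_type5 : tabulated 8 (sym3 0 1 0 0 0 1 : 'M[F]_3) (sym3 1 0 0 0 0 0).
Proof. exact: (@tabulated_pencil F 3 8 5 isT). Qed.

Lemma pencil3_type6 : tabulated 8 (sym3 0 1 0 0 0 0 : 'M[F]_3) (sym3 0 0 1 0 0 0).
Proof. exact: (@tabulated_pencil F 3 8 6 isT). Qed.

Lemma pencil3_type7 : tabulated 8 (sym3 1 0 0 0 0 0 : 'M[F]_3) (sym3 0 0 0 1 0 0).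
Proof. exact: (@tabulated_pencil F 3 8 7 isT). Qed.

Lemma pencil3_type8 : tabulated 8 (sym3 0 1 0 0 0 0 : 'M[F]_3) (sym3 1 0 0 0 0 0).
Proof. exact: (@tabulated_pencil F 3 8 8 isT). Qed.

(** The first form is x1^2, so only the restriction of the second form to the
    plane x1 = 0 and its coupling with x1 matter: the coefficient [a] can be
    subtracted.  That restriction is isotropic at the third basis vector; it
    has rank two if [e != 0], rank one if only [d != 0], and vanishes
    otherwise. *)
Lemma rank1_pencil_isotropic a b c d e :
  tabulated 8 (sym3 1 0 0 0 0 0) (sym3 a b c d e 0).
Proof.
have [-> |e0] := eqVneq e 0; last first.
  (* The restriction is hyperbolic: replace the second vector by an isotropic
     one, then make the first one orthogonal to the plane. *)
  suff: tabulated 8 (sym3 1 0 0 0 0 0 : 'M[F]_3) (sym3 0 0 0 0 1 0).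
    basis (1, - c / e, c * d / e ^+ 2 - b / e)
          (0, 1, - d / (2 * e)) (0, 0, e^-1) of_det (e^-1)
    comb 1 0 (2 * b * c / e - c ^+ 2 * d / e ^+ 2 - a) 1 of_det 1.
  (* Turn the hyperbolic plane into a sum of two squares. *)
  move: pencil3_type4.
  basis (0, 1, 1 / 2) (0, 'i, - 'i / 2) (1, 0, 0) of_det (- 'i)
  comb 0 1 1 0 of_det (- 1).
have [-> |d0] := eqVneq d 0; last first.
  have [-> |c0] := eqVneq c 0.
    move: pencil3_type7.
    basis (1, - b / d, 0) (0, 1, 0) (0, 0, 1) of_det 1
    comb 1 0 ((b ^+ 2 / d - a) / d) (d^-1) of_det (d^-1).
  have [s ds] := square_root d; rewrite -{}ds expf_eq0 /= in d0 *.
  move: pencil3_type5.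
  basis (1, - b / s ^+ 2, 0) (0, 0, c^-1) (0, s^-1, 0) of_det (- (c * s)^-1)
  comb (b ^+ 2 / s ^+ 2 - a) 1 1 0 of_det (- 1).
have [-> |b0] := eqVneq b 0; last first.
  move: pencil3_type8.
  basis (1, 0, 0) (0, b^-1, 0) (0, - c / b, 1) of_det (b^-1)
  comb (- a) 1 1 0 of_det (- 1).
have [-> |c0] := eqVneq c 0; last first.
  move: pencil3_type8.
  basis (1, 0, 0) (0, 0, c^-1) (0, 1, 0) of_det (- c^-1)
  comb (- a) 1 1 0 of_det (- 1).
move=> hi; case: (@not_indep_comb _ _ _ _ (- a) 1 _ _ hi).
  by rewrite sym3_comb -sym3_0; congr sym3; ring.
by rewrite oner_eq0 orbT.
Qed.

(** The plane x1 = 0 always contains an isotropic vector of the second form,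
    which can serve as third basis vector. *)
Lemma rank1_pencil a b c d e f :
  tabulated 8 (sym3 1 0 0 0 0 0) (sym3 a b c d e f).
Proof.
have [-> |d0] := eqVneq d 0.
  suff: tabulated 8 (sym3 1 0 0 0 0 0) (sym3 a c b f e 0).
    basis (1, 0, 0) (0, 0, 1) (0, 1, 0) of_det (-1) comb 1 0 0 1 of_det 1.
  exact: rank1_pencil_isotropic.
have [t ht] := quadratic_root f e d0.
suff: tabulated 8 (sym3 1 0 0 0 0 0) (sym3 a b (t * b + c) d (t * d + e) 0).
  rewrite -[X in tabulated _ _ (sym3 _ _ _ _ _ X)]ht.
  basis (1, 0, 0) (0, 1, 0) (0, t, 1) of_det 1 comb 1 0 0 1 of_det 1.
exact: rank1_pencil_isotropic.
Qed.

(** Here the second form is diagonal.  If it has rank three its pencil with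
    2 x1 x2 is diagonalised by the sum and the difference of the first two
    vectors, rescaled to have length one; if it has rank one, the roles of the
    generators are exchanged. *)
Lemma hyperbolic_diag a d f : f != 0 ->
  tabulated 8 (sym3 0 1 0 0 0 0) (sym3 a 0 0 d 0 f).
Proof.
have [r <-] := square_root f; rewrite expf_eq0 /= => r0.
have half (p : F) : p != 0 -> tabulated 8 (sym3 0 1 0 0 0 0) (sym3 p 0 0 0 0 (r ^+ 2)).
  have [s <-] := square_root p; rewrite expf_eq0 /= => s0.
  move: pencil3_type2.
  basis (s^-1, 0, 0) (0, s, 0) (0, 0, r^-1) of_det (r^-1)
  comb 0 1 1 0 of_det (- 1).
have [-> |a0] := eqVneq a 0; have [-> |d0] := eqVneq d 0.
- move: (@rank1_pencil 0 0 0 0 1 0).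
  basis (0, 0, r^-1) (1, 0, 0) (0, 1, 0) of_det (r^-1) comb 0 1 1 0 of_det (- 1).
- move: (half _ d0).
  basis (0, 1, 0) (1, 0, 0) (0, 0, 1) of_det (- 1) comb 1 0 0 1 of_det 1.
- exact: half.
have [s as_] := square_root a; have [t dt] := square_root d.
rewrite -{}as_ -{}dt !expf_eq0 /= in a0 d0 *.
(* The diagonals become (2, 2, 4) and, up to a scalar, (1, -1, 0); the length
   4 of the last vector makes their combinations (1, 0, 1) and (0, 1, 1). *)
move: pencil3_type1.
basis (s^-1, t^-1, 0) (s^-1, - t^-1, 0) (0, 0, 2 / r) of_det (- 4 / (s * t * r))
comb (s * t / 4) (1 / 4) (- (s * t) / 4) (1 / 4) of_det (s * t / 8).
Qed.

(** Two binary forms have a combination that is the square of a linear form,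
    because their discriminant is a quadratic polynomial in the coefficient. *)
Lemma hyperbolic_binary a b d :
  tabulated 8 (sym3 0 1 0 0 0 0) (sym3 a b 0 d 0 0).
Proof.
have nz (p q : F) : p != 0 -> tabulated 8 (sym3 0 1 0 0 0 0) (sym3 p b 0 q 0 0).
  move=> p0; have [t ht] := square_root (p * q).
  have -> : q = t ^+ 2 / p by rewrite ht; field.
  move: (@rank1_pencil 0 1 0 (- 2 * t / p) 0 0).
  basis (1, 0, 0) (- t / p, 1, 0) (0, 0, 1) of_det 1
  comb ((t - b) / p) (p^-1) 1 0 of_det (- p^-1).
have [-> |a0] := eqVneq a 0; last exact: nz.
have [-> |d0] := eqVneq d 0; last first.
  move: (nz _ 0 d0).
  basis (0, 1, 0) (1, 0, 0) (0, 0, 1) of_det (- 1) comb 1 0 0 1 of_det 1.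
move=> hi; case: (@not_indep_comb _ _ _ _ (- b) 1 _ _ hi).
  by rewrite sym3_comb -sym3_0; congr sym3; ring.
by rewrite oner_eq0 orbT.
Qed.

(** With the kernel vector e3 of 2 x1 x2 isotropic for the second form and
    coupled to e1 only, [a] is removed by adding a multiple of e3 to e1, which
    does not affect 2 x1 x2. *)
Lemma hyperbolic_half a b c d : c != 0 ->
  tabulated 8 (sym3 0 1 0 0 0 0) (sym3 a b c d 0 0).
Proof.
move=> c0; have [-> |d0] := eqVneq d 0.
  move: pencil3_type6.
  basis (1, 0, - a / (2 * c)) (0, 1, 0) (0, 0, c^-1) of_det (c^-1)
  comb 1 0 (- b) 1 of_det 1.
move: pencil3_type3.
basis (1, 0, - a / (2 * c)) (0, 1, 0) (0, 0, d / c) of_det (d / c)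
comb (- b / d) (d^-1) 1 0 of_det (- d^-1).
Qed.

(** The first form is 2 x1 x2, with kernel spanned by e3.  If e3 is not isotropic
    for the second form it splits off orthogonally; otherwise the coupling
    ([c], [e]) of e3 with e1 and e2 decides. *)
Lemma hyperbolic_pencil a b c d e f :
  tabulated 8 (sym3 0 1 0 0 0 0) (sym3 a b c d e f).
Proof.
have [-> |f0] := eqVneq f 0; last first.
  move: (@hyperbolic_diag (a - c ^+ 2 / f) (d - e ^+ 2 / f) _ f0).
  basis (1, 0, - c / f) (0, 1, - e / f) (0, 0, 1) of_det 1
  comb 1 0 (c * e / f - b) 1 of_det 1.
have [-> |c0] := eqVneq c 0; have [-> |e0] := eqVneq e 0.
- exact: hyperbolic_binary.
- move: (@hyperbolic_half d b _ a e0).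
  basis (0, 1, 0) (1, 0, 0) (0, 0, 1) of_det (- 1) comb 1 0 0 1 of_det 1.
- exact: hyperbolic_half.
suff: tabulated 8 (sym3 0 1 0 0 0 0 : 'M[F]_3) (sym3 0 0 1 0 1 0).
  (* Rescaling makes both couplings 1; multiples of e3 kill the squares, and
     the first generator absorbs the coefficient of x1 x2. *)
  basis (c^-1, 0, - a / (2 * c ^+ 2)) (0, e^-1, - d / (2 * e ^+ 2)) (0, 0, 1)
    of_det ((c * e)^-1)
  comb (c * e) 0 (a * e / (2 * c) + d * c / (2 * e) - b) 1 of_det (c * e).
(* 2 x1 x2 is a sum of two squares in e1 + e2 and i (e1 - e2), and the second
   form couples e3 to the former only. *)
move: pencil3_type2.
basis (1, 1, 0) (0, 0, 1) ('i, - 'i, 0) of_det (2 * 'i)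
comb (1 / 2) 0 0 (1 / 2) of_det (1 / 4).
Qed.

Lemma singular_degenerate a b a' b' c' d' e' f' :
  tabulated 8 (sym3 a b 0 0 0 0) (sym3 a' b' c' d' e' f').
Proof.
have [-> |b0] := eqVneq b 0; last first.
  move: (@hyperbolic_pencil (a' - a * b' / b + a ^+ 2 * d' / (4 * b ^+ 2))
    ((b' - a * d' / (2 * b)) / b) (c' - a * e' / (2 * b))
    (d' / b ^+ 2) (e' / b) f').
  basis (1, - a / (2 * b), 0) (0, b^-1, 0) (0, 0, 1) of_det (b^-1)
  comb 1 0 0 1 of_det 1.
have [-> |a0] := eqVneq a 0; last first.
  move: (@rank1_pencil a' b' c' d' e' f').
  basis (1, 0, 0) (0, 1, 0) (0, 0, 1) of_det 1 comb (a^-1) 0 0 1 of_det (a^-1).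
move=> hi; case: (@not_indep_comb _ _ _ _ 1 0 _ _ hi).
  by rewrite sym3_comb -sym3_0; congr sym3; ring.
by rewrite oner_eq0.
Qed.

(** The kernel vector e3 reduces the first form to a binary one, and an isotropic
    vector of that form, put in second place, kills [d]. *)
Lemma singular_pencil3 a b d a' b' c' d' e' f' :
  tabulated 8 (sym3 a b 0 d 0 0) (sym3 a' b' c' d' e' f').
Proof.
have [-> |d0] := eqVneq d 0; first exact: singular_degenerate.
have [t ht] := quadratic_root a b d0.
have -> : a = - (2 * b * t + d * t ^+ 2).
  by apply/eqP; rewrite -addr_eq0 addrA ht.
move: (@singular_degenerate d (b + t * d) d' (b' + t * d') e'
  (a' + 2 * b' * t + d' * t ^+ 2) (c' + t * e') f').
basis (0, 1, 0) (1, t, 0) (0, 0, 1) of_det (- 1) comb 1 0 0 1 of_det 1.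
Qed.

Lemma tabulated_sym3 (A B : 'M[F]_3) : A^T = A -> B^T = B -> tabulated 8 A B.
Proof.
move=> sA sB; apply: (@tabulated_singular _ _ _ _ ord_max) => // C D sC sD r0.
rewrite (sym3E sC) (sym3E sD).
have C0 j : C j ord_max = 0 by rewrite -sC; move/rowP/(_ j): r0; rewrite !mxE.
by rewrite !C0; apply: singular_pencil3.
Qed.
End Classification.

(** * Anticommuting square-zero matrices *)

Section Ranks.
Variable F : fieldType.

(** A rank one matrix K = u w has K_ij K_ji = K_ii K_jj, which for skew K reads
    - K_ij^2 = 0. *)
Lemma skew_rank_ge2 n (K : 'M[F]_n) :
  (2 : F) != 0 -> K^T = - K -> K != 0 -> (2 <= \rank K)%N.
Proof.
move=> two0 sK K0; have skew i j : K j i = - K i j.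
  by move/matrixP/(_ i j): sK; rewrite !mxE.
have diag0 i : K i i = 0.
  have /eqP := skew i i; rewrite -addr_eq0 -mulr2n -mulr_natl mulf_eq0 (negbTE two0).
  by move/eqP.
rewrite leqNgt ltnS; apply: contra K0 => rK.
have {rK} r1 : \rank K = 1%N \/ \rank K = 0%N by lia.
case: r1 => [r1|/eqP]; last by rewrite mxrank_eq0.
have := mulmx_base K; move: (col_base K) (row_base K); rewrite r1 => u w hK.
apply/eqP/matrixP => i j; rewrite [RHS]mxE.
have E k l : K k l = u k 0 * w 0 l by rewrite -hK mxE big_ord1.
apply/eqP; rewrite -sqrf_eq0 expr2 -[X in X * _]opprK -skew mulNr !E.
by rewrite mulrACA [w 0 i * _]mulrC mulrACA -!E !diag0 mulr0 oppr0.
Qed.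

(** The image of B A lies in the image of A and in the kernel of B, so the rank
    of A is at least twice that of A B; and A, being square-zero, has rank at
    most n/2. *)
Lemma anticommuting_nilpotent_rank n (A B : 'M[F]_n) :
  A *m A = 0 -> B *m B = 0 -> A *m B = - (B *m A) ->
  (4 * \rank (A *m B) <= n)%N.
Proof.
move=> AA BB AB; have rA := mulmx0_rank_max AA.
have := mxrank_mul_ker A B.
have : (\rank (B *m A) <= \rank (A :&: kermx B))%N.
  rewrite mxrankS // sub_capmx submxMl; apply/sub_kermxP.
  by rewrite -mulmxA AB mulmxN mulmxA BB mul0mx oppr0.
have -> : \rank (B *m A) = \rank (A *m B) by rewrite AB mxrank_opp.
lia.
Qed.

(** The rank of A V B is that of the product of A V and B V; if it is nonzero it
    is at least two, and then n is at least eight. *)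
Lemma small_products_vanish n (V A B : 'M[F]_n) :
  (2 : F) != 0 -> (n <= 7)%N -> V^T = V -> A^T = A -> B^T = B -> V \in unitmx ->
  A *m V *m A = 0 -> B *m V *m B = 0 -> A *m V *m B = - (B *m V *m A) ->
  A *m V *m B = 0.
Proof.
move=> two0 n7 sV sA sB uV AA BB AB; apply/eqP; apply: contraT => nz.
have skew : (A *m V *m B)^T = - (A *m V *m B).
  by rewrite !trmx_mul sA sB sV mulmxA AB opprK.
have := skew_rank_ge2 two0 skew nz.
have := @anticommuting_nilpotent_rank _ (A *m V) (B *m V).
rewrite !mulmxA AA BB !mul0mx => /(_ erefl erefl).
rewrite AB mulNmx => /(_ erefl).
rewrite -mulNmx mxrankMfree ?row_free_unit //.
move: (\rank _) => r; lia.
Qed.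

End Ranks.

(** * Isotropic subspaces and Witt extension *)

Section Isotropic.
Variables (F : numClosedFieldType).

Lemma isotropic_submx n m1 m2 m3 (V : 'M[F]_n) (E : 'M_(m1, n))
    (X : 'M_(m2, n)) (Y : 'M_(m3, n)) :
  E *m V *m E^T = 0 -> (X <= E)%MS -> (Y <= E)%MS -> X *m V *m Y^T = 0.
Proof.
move=> iE /submxP [X' ->] /submxP [Y' ->].
by rewrite trmx_mul -!mulmxA (mulmxA V) (mulmxA E) (mulmxA E) iE mul0mx mulmx0.
Qed.

Lemma isotropic_vector_gram r (G : 'M[F]_r.+2) : G^T = G ->
  exists2 w : 'rV_r.+2, w != 0 & w *m G *m w^T = 0.
Proof.
move=> sG; pose e i : 'rV[F]_r.+2 := delta_mx 0 i.
have eGe i j : e i *m G *m (e j)^T = (G i j)%:M.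
  rewrite -rowE trmx_delta -colE; apply/matrixP => a b.
  by rewrite !ord1 !mxE mulr1n.
have [G0|G0] := eqVneq (G 1 1) 0.
  exists (e 1); first by rewrite -mxrank_eq0 mxrank_delta.
  by rewrite eGe G0 raddf0.
have [t ht] := quadratic_root (G 0 0) (G 0 1) G0.
exists (e 0 + t *: e 1).
  apply/eqP => /rowP/(_ 0); rewrite !mxE /= mulr0 addr0 => /eqP.
  by rewrite oner_eq0.
rewrite linearD linearZ /= !mulmxDl !mulmxDr -!scalemxAl -!scalemxAr !eGe.
have -> : G 1 0 = G 0 1 by rewrite -[in LHS]sG mxE.
rewrite !scale_scalar_mx -!raddfD /= -(raddf0 (@scalar_mx F 1)) -ht.
by congr (_%:M); ring.
Qed.

Lemma isotropic_vector n k (V : 'M[F]_n) (D : 'M_(k, n)) :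
  V^T = V -> (2 <= \rank D)%N ->
  exists z : 'rV_n, [/\ z != 0, (z <= D)%MS & z *m V *m z^T = 0].
Proof.
move=> sV r2.
have [R [fR RD]] : exists R : 'M_(\rank D, n), row_free R /\ (R <= D)%MS.
  by exists (row_base D); rewrite row_base_free eq_row_base.
move: (\rank D) r2 R fR RD => [|[|r]] // _ R fR RD.
have [|w w0 hw] := @isotropic_vector_gram r (R *m V *m R^T).
  by rewrite !trmx_mul trmxK sV mulmxA.
exists (w *m R); split.
- by apply: contra w0 => /eqP h0; apply/eqP/(row_free_inj fR); rewrite h0 mul0mx.
- by apply: submx_trans RD; apply: submxMl.
- by rewrite -hw trmx_mul !mulmxA.
Qed.

(** As long as an isotropic subspace E0 has dimension k < n/2 rounded down, its
    orthogonal has dimension n - k, so a complement of E0 in it has dimension at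
    least two and contains an isotropic vector, which enlarges E0. *)
Lemma maximal_isotropic n (V E0 : 'M[F]_n) :
  V^T = V -> V \in unitmx -> E0 *m V *m E0^T = 0 ->
  exists E : 'M_(n./2, n), [/\ row_free E, E *m V *m E^T = 0 & (E0 <= E)%MS].
Proof.
move=> sV uV.
have rV (X : 'M[F]_n) : \rank (X *m V) = \rank X.
  by rewrite mxrankMfree ?row_free_unit.
have bound (X : 'M[F]_n) : X *m V *m X^T = 0 -> (\rank X <= n./2)%N.
  by move/mulmx0_rank_max; rewrite rV mxrank_tr; move: (\rank X) => r; lia.
have [k] := ubnP (n./2 - \rank E0)%N; elim: k E0 => // k IH E0 hk iE0.
have [rE|rE] := leqP n./2 (\rank E0).
  have [R [fR iR ER]] : exists R : 'M_(\rank E0, n),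
      [/\ row_free R, R *m V *m R^T = 0 & (E0 <= R)%MS].
    exists (row_base E0); rewrite row_base_free eq_row_base; split=> //.
    by apply: (isotropic_submx iE0); rewrite eq_row_base.
  have {}rE : \rank E0 = n./2 by apply/eqP; rewrite eqn_leq bound.
  by move: R fR iR ER; rewrite rE => R fR iR ER; exists R.
pose D := (kermx (V *m E0^T) :\: E0)%MS.
have rD : (2 <= \rank D)%N.
  have := mxrank_cap_compl (kermx (V *m E0^T)) E0; rewrite -/D mxrank_ker.
  have -> : \rank (V *m E0^T) = \rank E0.
    by rewrite -mxrank_tr trmx_mul trmxK sV rV.
  have := mxrankS (capmxSr (kermx (V *m E0^T)) E0).
  move: (\rank (_ :&: _)) (\rank D) (\rank E0) rE => a b c; lia.
have [z [z0 zD zVz]] := isotropic_vector sV rD.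
have zVE : z *m V *m E0^T = 0.
  rewrite -mulmxA; apply/sub_kermxP; apply: submx_trans zD _; exact: diffmxSl.
have EVz : E0 *m V *m z^T = 0.
  by apply: trmx_inj; rewrite !trmx_mul trmxK sV mulmxA zVE trmx0.
have iE1 : (E0 + z)%MS *m V *m (E0 + z)%MS^T = 0.
  apply: (@isotropic_submx _ _ _ _ V (col_mx E0 z)); rewrite ?addsmxE //.
  by rewrite tr_col_mx mul_col_mx mul_col_row iE0 EVz zVE zVz block_mx0.
have grow : (\rank E0 < \rank (E0 + z)%MS)%N.
  have : (E0 < E0 + z)%MS.
    rewrite ltmxE addsmxSl addsmx_sub submx_refl /=; apply: contra z0 => zE.
    by rewrite -submx0 -(capmx_diff (kermx (V *m E0^T)) E0) sub_capmx zD.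
  by rewrite ltmxErank => /andP [].
have [|E [fE iE EE]] := IH (E0 + z)%MS _ iE1.
  by move: grow rE hk; move: (\rank _) (\rank _) => r1 r2; lia.
by exists E; split=> //; apply: submx_trans EE; apply: addsmxSl.
Qed.

(** The bound [d <= 1] leaves only the extraction of one square root: a
    generator of the orthogonal line is anisotropic, since otherwise it would be
    orthogonal to the whole space. *)
Lemma orthonormal_complement n k d (V : 'M[F]_n) (X : 'M_(k, n)) :
  (n = k + d)%N -> (d <= 1)%N -> V^T = V -> V \in unitmx ->
  row_free (X *m V *m X^T) ->
  exists2 H : 'M_(d, n), X *m V *m H^T = 0 & H *m V *m H^T = 1%:M.
Proof.
move=> nkd d1 sV uV fX; case: d d1 nkd => [|[|//]] _ nkd.
  by exists 0; [rewrite trmx0 mulmx0 | apply/matrixP => - []].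
have : kermx (V *m X^T) != 0.
  rewrite -mxrank_eq0 mxrank_ker subn_eq0 -ltnNge.
  by apply: leq_ltn_trans (rank_leq_col _) _; lia.
case/rowV0Pn => h /sub_kermxP; rewrite mulmxA => hX h0.
have Xh : X *m V *m h^T = 0.
  by apply: trmx_inj; rewrite !trmx_mul trmxK sV mulmxA hX trmx0.
have [c hc] : exists c, h *m V *m h^T = c%:M.
  by exists ((h *m V *m h^T) 0 0); apply: mx11_scalar.
have c0 : c != 0.
  apply: (contraNneq _ h0) => c0; rewrite c0 raddf0 in hc.
  have XVh : col_mx X h *m (V *m h^T) = 0.
    by rewrite mul_col_mx !mulmxA Xh hc col_mx0.
  have : row_full (col_mx X h).
    suff /eqP rX : row_free (col_mx X h) by rewrite /row_full rX nkd.
    rewrite -kermx_eq0; apply: contraT => /rowV0Pn [w /sub_kermxP].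
    rewrite -(hsubmxK w) mul_row_col => hw.
    have w1 : lsubmx w = 0.
      apply: (row_free_inj fX); rewrite mul0mx -!mulmxA.
      have := congr1 (fun Y => Y *m V *m X^T) hw.
      by rewrite /= !mulmxDl -!mulmxA (mulmxA h) hX mulmx0 addr0 !mul0mx.
    move: hw; rewrite w1 mul0mx add0r [rsubmx w]mx11_scalar mul_scalar_mx.
    move/eqP; rewrite scaler_eq0 (negPf h0) orbF => /eqP->.
    by rewrite raddf0 row_mx0 eqxx.
  case/row_fullP => Y hY; have /eqP := congr1 (mulmx (invmx V *m Y)) XVh.
  rewrite mulmx0 !mulmxA -(mulmxA _ Y) hY mulmx1 mulVmx // mul1mx.
  by rewrite -(inj_eq trmx_inj) trmxK trmx0.
have [s cs] := square_root c; rewrite -{}cs expf_eq0 /= in c0 hc.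
exists (s^-1 *: h); first by rewrite linearZ /= -scalemxAr Xh scaler0.
rewrite linearZ /= -scalemxAr -!scalemxAl hc !scale_scalar_mx.
by congr (_%:M); field.
Qed.

Section Frame.
Variables (m d : nat).

(** Gram matrix of a frame made of two dual isotropic families of size [m] and an
    orthonormal family of size [d]. *)
Definition frame_gram : 'M[F]_(m + (m + d)) :=
  col_mx (row_mx 0 (row_mx 1%:M 0))
    (col_mx (row_mx 1%:M (row_mx 0 0)) (row_mx 0 (row_mx 0 1%:M))).

Lemma frame_gramK : frame_gram *m frame_gram = 1%:M.
Proof.
rewrite {1}/frame_gram !mul_col_mx !mul_row_col !mul0mx !add0r ?addr0.
rewrite !mul1mx !scalar_mx_block !block_mxEv !row_mx0.
by rewrite -[X in col_mx _ (row_mx X _)]col_mx0 -block_mxEh block_mxEv.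
Qed.

(** G0 is any family dual to E; subtracting half of its Gram matrix times E keeps
    it dual to E and makes it isotropic. *)
Lemma hyperbolic_frame (V : 'M[F]_(m + (m + d))) (E : 'M_(m, m + (m + d))) :
  (d <= 1)%N -> V^T = V -> V \in unitmx -> row_free E -> E *m V *m E^T = 0 ->
  exists2 Q : 'M_(m + (m + d)), usubmx Q = E & Q *m V *m Q^T = frame_gram.
Proof.
move=> d1 sV uV fE iE.
have : row_free (E *m V) by rewrite /row_free mxrankMfree ?row_free_unit.
case/row_freeP => G0' hG0; pose G0 := G0'^T.
have EG0 : E *m V *m G0^T = 1%:M by rewrite trmxK.
have G0E : G0 *m V *m E^T = 1%:M.
  by apply: trmx_inj; rewrite !trmx_mul trmxK sV mulmxA EG0 trmx1.
pose S := G0 *m V *m G0^T.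
have sS : S^T = S by rewrite !trmx_mul trmxK sV mulmxA.
pose G := G0 - (2^-1 *: S) *m E.
have EG : E *m V *m G^T = 1%:M.
  by rewrite linearB /= trmx_mul mulmxBr EG0 mulmxA iE mul0mx subr0.
have GE : G *m V *m E^T = 1%:M.
  by apply: trmx_inj; rewrite !trmx_mul trmxK sV mulmxA EG trmx1.
have GG : G *m V *m G^T = 0.
  rewrite {1}/G !mulmxBl -!(mulmxA _ E) -!(mulmxA _ (E *m V)) EG mulmx1.
  rewrite linearB /= mulmxBr -/S trmx_mul mulmxA G0E mul1mx linearZ /= sS.
  rewrite -addrA -opprD -scalerDl -mulr2n -(mulr_natl 2^-1).
  by rewrite mulfV ?pnatr_eq0 ?scale1r ?subrr.
have [||H] := @orthonormal_complement _ _ d V (col_mx E G) _ d1 sV uV.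
- by rewrite addnA.
- apply/row_freeP; exists (block_mx 0 1%:M 1%:M 0).
  rewrite tr_col_mx !mul_col_mx !mul_mx_row iE EG GE GG.
  rewrite -mul_col_mx -block_mxEv mulmx_block.
  by rewrite !mul0mx !mulmx0 !mulmx1 !add0r !addr0 -scalar_mx_block.
rewrite !mul_col_mx -[RHS]col_mx0 => /eq_col_mx [EH GH] HH.
have tr0 p q (X : 'M_(p, _)) (Y : 'M_(q, _)) :
    X *m V *m Y^T = 0 -> Y *m V *m X^T = 0.
  by move=> h; apply: trmx_inj; rewrite !trmx_mul trmxK sV mulmxA h trmx0.
exists (col_mx E (col_mx G H)); first by rewrite col_mxKu.
rewrite !tr_col_mx !mul_col_mx !mul_mx_row iE EG GE GG HH EH GH.
by rewrite (tr0 _ _ _ _ EH) (tr0 _ _ _ _ GH).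
Qed.
End Frame.

Lemma frame_unit m d (V Q : 'M[F]_(m + (m + d))) :
  Q *m V *m Q^T = frame_gram m d -> Q \in unitmx.
Proof.
move=> hQ; suff : Q *m (V *m Q^T *m frame_gram m d) = 1%:M by case/mulmx1_unit.
by rewrite !mulmxA hQ frame_gramK.
Qed.

(** Witt's theorem for the two isotropic families E1 and E2 of maximal size: both
    extend to frames with the same Gram matrix, and comparing the two frames
    gives the isometry. *)
Lemma witt_extension n m d (V1 V2 : 'M[F]_n) (E1 E2 : 'M_(m, n)) :
  n = (m + (m + d))%N -> (d <= 1)%N ->
  V1^T = V1 -> V1 \in unitmx -> row_free E1 -> E1 *m V1 *m E1^T = 0 ->
  V2^T = V2 -> V2 \in unitmx -> row_free E2 -> E2 *m V2 *m E2^T = 0 ->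
  exists Q, [/\ Q \in unitmx, E2 *m Q = E1 & Q *m V1 *m Q^T = V2].
Proof.
move=> nE; subst n => d1 sV1 uV1 fE1 iE1 sV2 uV2 fE2 iE2.
have [Q1 QE1 hQ1] := hyperbolic_frame d1 sV1 uV1 fE1 iE1.
have [Q2 QE2 hQ2] := hyperbolic_frame d1 sV2 uV2 fE2 iE2.
have [u1 u2] := (frame_unit hQ1, frame_unit hQ2).
exists (invmx Q2 *m Q1); split; first by rewrite unitmx_mul unitmx_inv u2.
  by rewrite -QE2 mul_usub_mx mulmxA mulmxV // mul1mx.
rewrite trmx_mul trmx_inv !mulmxA -(mulmxA _ Q1) -(mulmxA _ (Q1 *m V1)) hQ1.
by rewrite -hQ2 !mulmxA mulVmx // mul1mx mulmxK ?unitmx_tr.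
Qed.

End Isotropic.

(** * Normal form of an embedding *)

Section Embedding.
Variable F : numClosedFieldType.

Lemma bullet_mx0 n (U X Y : 'M[F]_n) : bullet_mx U X Y = 0 ->
  X *m invmx U *m Y = - (Y *m invmx U *m X).
Proof.
move/eqP; rewrite scaler_eq0 invr_eq0 pnatr_eq0 /= addr_eq0.
by move/eqP.
Qed.

(** Every product of two elements of the nilpotent part of J20 is zero, which
    becomes the anticommutation of the images of its basis. *)
Lemma embedding_pencil n (L : set 'M[F]_n) : jordan_embedding (J20 F) L ->
  exists U A B : 'M[F]_n,
    [/\ U^T = U, U \in unitmx, A^T = A & B^T = B] /\
    [/\ A *m invmx U *m A = 0, B *m invmx U *m B = 0,
        A *m invmx U *m B = - (B *m invmx U *m A), indep A B &
        L = [set M | exists c x y, M = c *: U + (x *: A + y *: B)]].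
Proof.
case=> U [uU [f [[linf mulf onef] injf ->]]].
pose e i : J20 F := (0, delta_mx 0 i).
have sym (X : 'S[F]_n) : (symmx_val X)^T = X by apply/symmetricmxP/(valP X).
have flin a u v : symmx_val (f (a *: u + v)) = a *: symmx_val (f u) + symmx_val (f v).
  by rewrite linf.
have fD u v : symmx_val (f (u + v)) = symmx_val (f u) + symmx_val (f v).
  by have := flin 1 u v; rewrite !scale1r.
have f0 : symmx_val (f 0) = 0.
  by have /eqP := fD 0 0; rewrite addr0 -subr_eq0 opprD addNKr oppr_eq0 => /eqP.
have fZ a u : symmx_val (f (a *: u)) = a *: symmx_val (f u).
  by have := flin a u 0; rewrite addr0 f0 addr0.
have fE c x y : symmx_val (f (c *: (1, 0) + (x *: e 0 + y *: e 1))) =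
    c *: symmx_val U + (x *: symmx_val (f (e 0)) + y *: symmx_val (f (e 1))).
  by rewrite !fD !fZ onef.
have ee0 i j : f (e i) *m invmx U *m f (e j) = - (f (e j) *m invmx U *m f (e i)).
  apply: bullet_mx0; have := mulf (e i) (e j).
  rewrite /= /J20_mul /= mulr0 !scale0r addr0 => /(congr1 (@symmx_val _ _)) /= <-.
  exact: f0.
have ee i : f (e i) *m invmx U *m f (e i) = 0.
  have /eqP := ee0 i i; rewrite -addr_eq0 -mulr2n -scaler_nat scaler_eq0 pnatr_eq0.
  by move/eqP.
exists U, (f (e 0)), (f (e 1)); split; first by split.
split=> //.
  move=> x y h; have : f (0 *: (1, 0) + (x *: e 0 + y *: e 1)) = f 0.
    by apply/val_inj; rewrite /= fE scale0r add0r h f0.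
  move/injf => /(congr1 snd) /= /rowP h2.
  have := h2 0; have := h2 1; rewrite !mxE /= !(mulr0, mulr1, add0r, addr0).
  by [].
apply/seteqP; split=> M /=.
  case=> -[c v] _ <-; exists c, (v 0 0), (v 0 1); rewrite -fE; congr (symmx_val (f _)).
  congr pair; first by rewrite /= /GRing.scale /= !mulr0 !addr0 mulr1.
  apply/rowP => i; rewrite !mxE /= mulr0 add0r.
  by case: i => [[|[|//]] hi]; rewrite /= !(mulr0, mulr1, add0r, addr0);
    congr (v _ _); apply/val_inj.
case=> c [x [y ->]]; exists (c *: (1, 0) + (x *: e 0 + y *: e 1)) => //.
Qed.

Lemma antidiag_entry n (i j : 'I_n) :
  antidiag_mx F n i j = ((i + j)%N == n.-1)%:R.
Proof.
rewrite mxE; suff -> : (j == rev_ord i) = ((i + j)%N == n.-1) by [].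
apply/eqP/eqP => [->|h] /=; first by have := ltn_ord i; lia.
by apply/val_inj => /=; have := ltn_ord i; lia.
Qed.

Lemma antidiag_sym n : (antidiag_mx F n)^T = antidiag_mx F n.
Proof. by apply/matrixP => i j; rewrite mxE !antidiag_entry addnC. Qed.

Lemma antidiagK n : antidiag_mx F n *m antidiag_mx F n = 1%:M.
Proof.
apply/matrixP => i j; rewrite mxE (bigD1 (rev_ord i)) //= big1 ?addr0.
  by rewrite !mxE eqxx mul1r rev_ordK eq_sym.
by move=> k ki; rewrite !mxE (negPf ki) mul0r.
Qed.

Lemma antidiag_unit n : antidiag_mx F n \in unitmx.
Proof. by have /mulmx1_unit [] := antidiagK n. Qed.

(** The first n/2 coordinate vectors, with the cast that occurs in [diag_mx0]. *)
Definition corner n : 'M[F]_(n./2, n) :=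
  castmx (erefl, half_add_uphalf n) (row_mx 1%:M 0).

Lemma corner_entry n i j : corner n i j = (i == j :> nat)%:R.
Proof.
rewrite castmxE !mxE; case: splitP => k /= jk; rewrite !mxE jk //.
by case: eqP => // ik; have := ltn_ord i; rewrite ik; lia.
Qed.

Lemma diag_mx0E n (A : 'M[F]_(n./2)) : diag_mx0 A = (corner n)^T *m A *m corner n.
Proof.
suff gen m p k (e : (m + p)%N = k) (X : 'M[F]_m) :
    castmx (e, e) (block_mx X 0 0 0) =
    (castmx (erefl, e) (row_mx 1%:M 0))^T *m X *m castmx (erefl, e) (row_mx 1%:M 0).
  exact: gen.
case: _ / e; rewrite !castmx_id tr_row_mx trmx1 trmx0 mul_col_mx mul1mx mul0mx.
by rewrite mul_col_row mulmx1 !mulmx0 mul0mx.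
Qed.

Lemma corner_free n : row_free (corner n).
Proof.
suff gen m p k (e : (m + p)%N = k) :
    row_free (castmx (erefl, e) (row_mx (1%:M : 'M[F]_m) 0)).
  exact: gen.
case: _ / e; apply/row_freeP; exists (row_mx 1%:M 0)^T.
by rewrite castmx_id tr_row_mx trmx1 trmx0 mul_row_col mulmx1 mulmx0 addr0.
Qed.

Lemma half_le n : (n./2 <= n)%N. Proof. by lia. Qed.

Lemma corner_rowsub n : corner n = rowsub (widen_ord (half_le n)) 1%:M.
Proof. by apply/matrixP => i j; rewrite corner_entry !mxE. Qed.

Lemma corner_isotropic n : corner n *m antidiag_mx F n *m (corner n)^T = 0.
Proof.
rewrite corner_rowsub mul_rowsub_mx mul1mx trmx_mxsub trmx1 mulmx_colsub mulmx1.
apply/matrixP => i j; rewrite !mxE.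
have -> // : (widen_ord (half_le n) j == rev_ord (widen_ord (half_le n) i)) = false.
by apply/negP => /eqP/(congr1 val) /=; have := ltn_ord i; have := ltn_ord j; lia.
Qed.

Lemma sym_factor m n (E : 'M[F]_(m, n)) (A : 'M_n) :
  row_free E -> A^T = A -> (A <= E)%MS ->
  exists2 A' : 'M_m, A'^T = A' & A = E^T *m A' *m E.
Proof.
move=> /row_freeP [R ER] sA /submxP [X AX].
have AR : A *m R *m E = A by rewrite AX -mulmxA -mulmxA (mulmxA E) ER mul1mx.
exists (R^T *m A *m R); first by rewrite !trmx_mul trmxK sA mulmxA.
have -> : E^T *m (R^T *m A *m R) *m E = E^T *m (R^T *m A).
  by rewrite -!mulmxA (mulmxA A) AR.
by apply: trmx_inj; rewrite !trmx_mul !trmxK sA AR.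
Qed.

(** The rows of both generators span an isotropic subspace for the inverse of U;
    it is moved into the span of the first coordinates.  Replacing the chosen basis
    E of the isotropic subspace by g^-T E changes the corner by congruence
    with [g]. *)
Lemma embedding_corner n (L : set 'M[F]_n) : (n <= 7)%N ->
  jordan_embedding (J20 F) L ->
  exists A B : 'M[F]_(n./2), [/\ A^T = A, B^T = B, indep A B &
    forall g, g \in unitmx -> congruent L
      [set M | exists c x y, M = c *: antidiag_mx F n +
         diag_mx0 (g *m (x *: A + y *: B) *m g^T)]].
Proof.
move=> n7 /embedding_pencil [U [N1 [N2 [[sU uU s1 s2] [h11 h22 h12 hi ->]]]]].
pose V := invmx U.
have sV : V^T = V by rewrite trmx_inv sU.
have uV : V \in unitmx by rewrite unitmx_inv.
have p12 : N1 *m V *m N2 = 0.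
  by apply: small_products_vanish; rewrite ?pnatr_eq0.
have p21 : N2 *m V *m N1 = 0.
  by apply/eqP; rewrite -oppr_eq0 -h12; apply/eqP.
have [|E [fE iE SE]] := @maximal_isotropic _ _ V (N1 + N2)%MS sV uV.
  apply: (@isotropic_submx _ _ _ _ _ V (col_mx N1 N2)); rewrite ?addsmxE //.
  by rewrite tr_col_mx mul_col_mx mul_col_row s1 s2 h11 h22 p12 p21 block_mx0.
move: SE; rewrite addsmx_sub => /andP [S1 S2].
have [A sA hA] := sym_factor fE s1 S1; have [B sB hB] := sym_factor fE s2 S2.
have hAB x y : x *: N1 + y *: N2 = E^T *m (x *: A + y *: B) *m E.
  by rewrite hA hB mulmxDr mulmxDl -!scalemxAr -!scalemxAl.
exists A, B; split=> //.
  by move=> x y h; apply: hi; rewrite hAB h mulmx0 mul0mx.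
move=> g ug; have ugi : (invmx g)^T \in unitmx by rewrite unitmx_tr unitmx_inv.
pose E1 := (invmx g)^T *m E.
have fE1 : row_free E1.
  by rewrite /row_free (eqmxMfull _ _) ?row_full_unit.
have iE1 : E1 *m V *m E1^T = 0.
  by apply: (isotropic_submx iE); rewrite submxMl.
have nE : n = (n./2 + (n./2 + odd n))%N by lia.
have [Q [uQ EQ hQ]] := witt_extension nE (leq_b1 _) sV uV fE1 iE1
    (antidiag_sym n) (antidiag_unit n) (corner_free n) (corner_isotropic n).
pose P := invmx Q^T.
have PQ : P *m Q^T = 1%:M by rewrite mulVmx ?unitmx_tr.
have QP : Q *m P^T = 1%:M by rewrite trmx_inv trmxK mulmxV.
have PUP : P *m U *m P^T = antidiag_mx F n.
  have : P *m U *m P^T *m antidiag_mx F n = 1%:M.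
    rewrite -hQ !mulmxA -(mulmxA _ P^T) (mulmx1C QP) mulmx1.
    by rewrite -(mulmxA P) mulmxV // mulmx1.
  move/(congr1 (mulmx^~ (antidiag_mx F n))).
  by rewrite /= -(mulmxA _ _ (antidiag_mx F n)) antidiagK mulmx1 mul1mx.
have PEP (X : 'M_(n./2)) : P *m (E^T *m X *m E) *m P^T = diag_mx0 (g *m X *m g^T).
  have -> : E = g^T *m corner n *m Q.
    by rewrite -mulmxA EQ /E1 mulmxA -trmx_mul mulVmx // trmx1 mul1mx.
  rewrite !trmx_mul trmxK !mulmxA PQ mul1mx -(mulmxA _ Q) QP mulmx1.
  by rewrite diag_mx0E !mulmxA.
have Pcomb c x y : P *m (c *: U + (x *: N1 + y *: N2)) *m P^T =
    c *: antidiag_mx F n + diag_mx0 (g *m (x *: A + y *: B) *m g^T).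
  by rewrite hAB mulmxDr mulmxDl -scalemxAr -scalemxAl PUP PEP.
exists P; first by rewrite unitmx_inv unitmx_tr.
apply/seteqP; split=> M /=.
  case=> c [x [y ->]]; exists (c *: U + (x *: N1 + y *: N2)); first by exists c, x, y.
  by rewrite Pcomb.
by case=> X [c [x [y ->]]] <-; exists c, x, y; rewrite Pcomb.
Qed.

(** Parametrisation by two independent generators, which the pairs ([m], [k])
    outside the table do not have. *)
Definition is_pencil m k := forall x y : F,
  pencil m k x y = x *: pencil m k 1 0 + y *: pencil m k 0 1 /\
  (pencil m k x y = 0 -> x = 0 /\ y = 0).

Lemma is_pencil2 k : (1 <= k <= 2)%N -> is_pencil 2 k.
Proof.
case: k => [|[|[|//]]] // _ x y; split.
1,3: apply/matrixP => - [[|[|//]] hi] [[|[|//]] hj]; rewrite !mxE /=; ring.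
all: move/matrixP => h.
all: have := (h 0 0, h 0 1, h 1 1); rewrite !mxE /= => - [[? ?] ?]; by split.
Qed.

Lemma is_pencil3 k : (1 <= k <= 8)%N -> is_pencil 3 k.
Proof.
move=> hk x y; split.
  apply/matrixP => i j; rewrite !mxE.
  move: k hk => [|[|[|[|[|[|[|[|[|//]]]]]]]]] // _;
  by case: i j => [[|[|[|//]]] hi] [[|[|[|//]]] hj]; rewrite /=; ring.
move/matrixP => h.
have := (h 0 0, h 0 1, h 0 ord_max, h 1 1, h ord_max ord_max); rewrite !mxE /= {h}.
by move: k hk => [|[|[|[|[|[|[|[|[|//]]]]]]]]] // _ /= [[[[? ?] ?] ?] ?]; split.
Qed.

(** The tabulated pencil is contained in a congruent image of the corner pencil;
    both are two-dimensional, so they coincide. *)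
Lemma embedding_classified n K (L : set 'M[F]_n) : (n <= 7)%N ->
  (forall A B : 'M[F]_(n./2), A^T = A -> B^T = B -> tabulated K A B) ->
  (forall k, (1 <= k <= K)%N -> is_pencil n./2 k) ->
  jordan_embedding (J20 F) L ->
  exists2 k, (1 <= k <= K)%N & congruent L (Cspace F n k).
Proof.
move=> n7 tab pen /(embedding_corner n7) [A [B [sA sB hi cong]]].
have [k hk [g ug [[a [b h1]] [c [d h2]]]]] := tab A B sA sB hi.
exists k => //; have := cong g ug; congr congruent.
have hD : a * d - b * c != 0.
  apply: (@indep_comb _ _ A B) => x y hxy.
  apply: (pen k hk x y).2; rewrite (pen k hk x y).1 h1 h2 congr_comb hxy.
  by rewrite mulmx0 mul0mx.
apply/seteqP; split=> M /= [e [x [y ->]]].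
  have [x' [y' ->]] := solve_comb A B hD x y.
  by exists e, x', y'; rewrite (pen k hk x' y').1 h1 h2 congr_comb.
exists e, (x * a + y * c), (x * b + y * d).
have -> : (x * a + y * c) *: A + (x * b + y * d) *: B =
    x *: (a *: A + b *: B) + y *: (c *: A + d *: B).
  by rewrite !scalerDr !scalerA addrACA -!scalerDl.
by rewrite (pen k hk x y).1 h1 h2 congr_comb.
Qed.

Lemma mx_small_dep m (A B : 'M[F]_m) : (m <= 1)%N -> ~ indep A B.
Proof.
case: m A B => [|[|//]] A B _ hi.
  have [|/eqP] := hi 1 1; last by rewrite oner_eq0.
  by apply/matrixP => - [].
have [B0|B0] := eqVneq (B 0 0) 0.
  have [|_ /eqP] := hi 0 1; last by rewrite oner_eq0.
  by apply/matrixP => i j; rewrite !ord1 !mxE B0; ring.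
have [|/eqP] := hi 1 (- A 0 0 / B 0 0); last by rewrite oner_eq0.
by apply/matrixP => i j; rewrite !ord1 !mxE; field.
Qed.

End Embedding.

Theorem theorem3p4 (R : realType) (n : nat) :
  ((1 <= n <= 3)%N ->
     ~ exists L : set 'M[R[i]]_n, jordan_embedding (J20 R[i]) L) /\
  ((4 <= n <= 7)%N ->
     forall L : set 'M[R[i]]_n, jordan_embedding (J20 R[i]) L ->
       exists2 k : nat,
         (1 <= k <= if (n <= 5)%N then 2 else 8)%N &
         congruent L (Cspace R[i] n k)).
Proof.
split=> [n3 [L hL]|n47 L hL].
  have [|A [B [_ _ hi _]]] := embedding_corner _ hL; first by lia.
  by apply: (mx_small_dep _ hi); lia.
apply: embedding_classified => //; first by lia.
  move=> A B; have [n5|n5] := leqP n 5.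
    have : n./2 = 2 by lia.
    by move: A B; move: (n./2) => m A B m2; subst m; apply: tabulated_sym2.
  have : n./2 = 3 by lia.
  by move: A B; move: (n./2) => m A B m3; subst m; apply: tabulated_sym3.
case: leqP => n5 k hk.
  have -> : n./2 = 2 by lia.
  exact: is_pencil2.
have -> : n./2 = 3 by lia.
exact: is_pencil3.
Qed.
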